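(* Let $G$ be an ambitable topological group and let $S\subseteq\mathbf{M}(rG)$ be such that $S$ with the convolution operation $\star$ is a semigroup and $\overline{rG}\subseteq S$. Then, with $S$ carrying the weak$^*$ topology inherited from $\mathbf{M}(rG)$, $\Lambda(S)=\mathbf{M_u}(rG)\cap S$.
   Context: All topological groups are assumed to be Hausdorff, and linear spaces are over $\mathbb{R}$. For a topological group $G$, $\mathcal{RP}(G)$ denotes the set of all continuous right-invariant pseudometrics $\Delta$ on $G$ (right-invariant: $\Delta(xz,yz)=\Delta(x,y)$ for all $x,y,z\in G$). The right uniformity on $G$ is the uniformity generated by $\mathcal{RP}(G)$; $G$ with this uniformity is denoted $rG$. $\mathbf{U_b}(rG)$ is the space of all bounded uniformly continuous real-valued functions on $rG$ (with the sup norm). For a pseudometric $\Delta$ on $G$, $\mathrm{BLip}^+(\Delta)=\{f:G\to\mathbb{R} \mid 0\le f(x)\le 1 \text{ and } |f(x)-f(y)|\le \Delta(x,y) \text{ for all } x,y\in G\}$, always considered with the topology of pointwise convergence (as a subspace of $\mathbb{R}^G$). For $f:G\to\mathbb{R}$ and $x\in G$, $\rho^x(f)$ is the function $z\mapsto f(zx)$; $\mathrm{orb}(f)=\{\rho^x(f)\mid x\in G\}$, and $\overline{\mathrm{orb}(f)}$ is its closure in $\mathbb{R}^G$. $G$ is ambitable if for each $\Delta\in\mathcal{RP}(G)$ there exists $f\in\mathbf{U_b}(rG)$ such that $\mathrm{BLip}^+(\Delta)\subseteq\overline{\mathrm{orb}(f)}$. $\mathbf{M}(rG)$ is the norm dual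 of $\mathbf{U_b}(rG)$. $\mathbf{M_u}(rG)$ is the subspace of those $\mu\in\mathbf{M}(rG)$ that are continuous on $\mathrm{BLip}^+(\Delta)$ for each $\Delta\in\mathcal{RP}(G)$. For $x\in G$, $\delta_x\in\mathbf{M}(rG)$ is given by $\delta_x(f)=f(x)$. For $\mu,\nu\in\mathbf{M}(rG)$ the convolution $\mu\star\nu\in\mathbf{M}(rG)$ is defined by $(\mu\star\nu)(f)=\mu\bigl(x\mapsto\nu(y\mapsto f(xy))\bigr)$ for $f\in\mathbf{U_b}(rG)$. $\overline{rG}$ is the weak$^*$ closure of $\{\delta_x\mid x\in G\}$ in $\mathbf{M}(rG)$. $\mathbf{M}(rG)$ with $\star$ and the weak$^*$ topology is a right topological semigroup, i.e. $x\mapsto xy$ is continuous for each $y$. For a right topological semigroup $S$, its topological centre is $\Lambda(S)=\{x\in S\mid \text{the mapping } y\mapsto xy \text{ is continuous on } S\}$. *)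

(* Defs.v *)
From HB Require Import structures.
From mathcomp Require Import all_boot all_order all_algebra.
From mathcomp Require Import all_classical all_reals all_analysis.

Set Implicit Arguments.
Unset Strict Implicit.
Unset Printing Implicit Defensive.
Import Order.TTheory GRing.Theory Num.Theory.
Import numFieldNormedType.Exports.
Local Open Scope classical_set_scope.
Local Open Scope ring_scope.

HB.mixin Record isTopologicalGroup G & Topological G & Group G := {
  mulg_continuous : continuous (fun z : G * G => (z.1 * z.2)%g) ;
  invg_continuous : continuous (fun x : G => x^-1%g)
}.

#[short(type="topologicalGroupType")]
HB.structure Definition TopologicalGroup :=
  {G of Topological G & Group G & isTopologicalGroup G}.

(* The uniformity put on this alias of G is generated by R-valued pseudometrics,
   hence the parameter R. *)
Definition right_unif (R : realType) (G : topologicalGroupType) : Type := G.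

Section RightUniformity.
Context (R : realType) (G : topologicalGroupType).

Definition is_pseudometric (D : G -> G -> R) : Prop :=
  [/\ forall x y, 0 <= D x y,
      forall x, D x x = 0,
      forall x y, D x y = D y x &
      forall x y z, D x z <= D x y + D y z].

Definition right_invariant (D : G -> G -> R) : Prop :=
  forall x y z : G, D (x * z)%g (y * z)%g = D x y.

Definition RP : set (G -> G -> R) :=
  [set D | [/\ is_pseudometric D,
               continuous (fun z : G * G => D z.1 z.2 : R^o) &
               right_invariant D]].

Lemma RP0 : RP (fun _ _ => 0).
Proof.
split; [by split=> // *; rewrite addr0 | | by []].
by move=> ?; exact: cvg_cst.
Qed.

Lemma RP_max D E : RP D -> RP E -> RP (fun x y => Num.max (D x y) (E x y)).
Proof.
move=> [[D0 Dxx Ds Dt] Dc Dr] [[E0 Exx Es Et] Ec Er]; split.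
- split=> [x y|x|x y|x y z].
  + by rewrite le_max D0.
  + by rewrite Dxx Exx maxxx.
  + by rewrite Ds Es.
  + rewrite ge_max; apply/andP; split.
      by apply: le_trans (Dt x y z) _; apply: lerD; rewrite le_max lexx.
    by apply: le_trans (Et x y z) _; apply: lerD; rewrite le_max lexx orbT.
- move=> z; exact: (@continuous_max R _ _ _ z (Dc z) (Ec z)).
- by move=> x y z; rewrite Dr Er.
Qed.

Lemma RP_ltrans D (x : G) : RP D -> RP (fun y z => D (x * y)%g (x * z)%g).
Proof.
move=> [[D0 Dxx Ds Dt] Dc Dr]; split.
- by split=> *; [exact: D0|exact: Dxx|exact: Ds|exact: Dt].
- move=> z.
  have mc (y : G) : {for y, continuous (fun y : G => (x * y)%g)}.
    apply: (@continuous_comp _ _ _ (fun y => (x, y)) (fun z : G * G => (z.1 * z.2)%g)).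
      by apply: cvg_pair => /=; [exact: cvg_cst|exact: cvg_id].
    exact: mulg_continuous.
  apply: (@continuous_comp _ _ _ (fun z : G * G => ((x * z.1)%g, (x * z.2)%g))
    (fun z : G * G => D z.1 z.2 : R^o)); last exact: Dc.
  apply: cvg_pair => /=.
  + apply: (@continuous_comp _ _ _ fst (fun y : G => (x * y)%g)); last exact: mc.
    exact: cvg_fst.
  + apply: (@continuous_comp _ _ _ snd (fun y : G => (x * y)%g)); last exact: mc.
    exact: cvg_snd.
- by move=> y z w; rewrite !mulgA Dr.
Qed.

HB.instance Definition _ := Choice.on (right_unif R G).

(* RP is closed under max (RP_max), so these basic entourages already form a
   filter base: no finite intersections are needed. *)
Definition right_entourage : set_system (right_unif R G * right_unif R G) :=
  filter_from [set De : (G -> G -> R) * R | RP De.1 /\ 0 < De.2]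
              (fun De => [set xy | De.1 xy.1 xy.2 < De.2]).

Lemma right_entourage_filter : Filter right_entourage.
Proof.
apply: filter_from_filter; first by exists (fun _ _ => 0, 1); split=> //=; exact: RP0.
move=> [D e] [E d] /= [RD e0] [RE d0].
exists (fun x y => Num.max (D x y) (E x y), Num.min e d) => /=.
  by split; [exact: RP_max|rewrite lt_min e0].
by move=> [x y] /=; rewrite gt_max !lt_min => /andP[/andP[-> _] /andP[_ ->]].
Qed.

Local Open Scope relation_scope.

Lemma right_entourage_diagonal A : right_entourage A -> diagonal `<=` A.
Proof.
move=> [[D e] /= [[[_ Dxx _ _] _ _] e0] DA] [x y] /diagonalP <-.
by apply: DA; rewrite /= Dxx.
Qed.

Lemma right_entourage_inv A : right_entourage A -> right_entourage A^-1.
Proof.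
move=> [[D e] /= RDe DA]; exists (D, e) => //= -[x y] /= xy.
by apply: DA; have [[[_ _ Ds _] _ _] _] := RDe; rewrite /= Ds.
Qed.

Lemma right_entourage_split A : right_entourage A ->
  exists2 B, right_entourage B & B \; B `<=` A.
Proof.
move=> [[D e] /= [RD e0] DA]; exists [set xy | D xy.1 xy.2 < e / 2].
  by exists (D, e / 2) => //=; split=> //; exact: divr_gt0.
move=> [x z] [y /= xy yz]; apply: DA => /=.
have [[_ _ _ Dt] _ _] := RD.
by apply: le_lt_trans (Dt x y z) _; rewrite (splitr e) ltrD.
Qed.

HB.instance Definition _ := isUniform.Build (right_unif R G)
  right_entourage_filter right_entourage_diagonal
  right_entourage_inv right_entourage_split.

End RightUniformity.

Section BoundedUniform.
Context (R : realType) (G : topologicalGroupType).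
Local Notation rG := (right_unif R G).

Definition Ub_set : set (rG -> R^o) :=
  [set f | bounded_fun f /\ unif_continuous f].

(* epsilon-delta_pt forms, used only in the construction below *)
Lemma bounded_funE (f : rG -> R^o) :
  bounded_fun f <-> exists C, forall x, `|f x| <= C.
Proof.
split=> [/pinfty_ex_gt0[C _ fC]|[C fC]]; first by exists C => x; exact: fC.
exists C; split; first exact: num_real.
by move=> K CK x _; exact: le_trans (fC x) (ltW CK).
Qed.

Lemma unif_continuousE (f : rG -> R^o) : unif_continuous f <->
  forall e : R, 0 < e -> exists2 D : G -> G -> R, RP D &
    exists2 d : R, 0 < d & forall x y, D x y < d -> `|f x - f y| < e.
Proof.
split=> [fu e e0|H A].
  have /= := fu [set xy : R^o * R^o | ball xy.1 e xy.2].
  rewrite -entourage_ballE; case; first by exists e.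
  move=> [D d] /= [RD d0] DA; exists D => //; exists d => // x y xy.
  by have := DA (x, y) xy.
rewrite -entourage_ballE => -[e e0 eA]; have [D RD [d d0 Dd]] := H e e0.
exists (D, d) => //= -[x y] /= xy; apply: eA => /=; exact: Dd.
Qed.

Definition Ub_pred : {pred rG -> R^o} := mem Ub_set.

Lemma Ub_predP f : f \in Ub_pred <-> Ub_set f.
Proof. by rewrite /Ub_pred; split=> [/set_mem|/mem_set]. Qed.

Lemma Ub_submod : submod_closed Ub_pred.
Proof.
split=> [|a f g /Ub_predP[/bounded_funE[C fC] /unif_continuousE fu]
               /Ub_predP[/bounded_funE[K gK] /unif_continuousE gu]].
  apply/Ub_predP; split.
    by apply/bounded_funE; exists 0 => x; rewrite normr0.
  apply/unif_continuousE => e e0; exists (fun _ _ => 0); first exact: RP0.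
  by exists 1 => // x y _; rewrite subrr normr0.
have scE h x : (a *: h : rG -> R^o) x = a * h x by [].
apply/Ub_predP; split.
  apply/bounded_funE; exists (`|a| * C + K) => x.
  apply: (le_trans (ler_normD _ _)); rewrite lerD//.
  by rewrite scE normrM ler_wpM2l.
apply/unif_continuousE => e e0.
have a0 : 0 < `|a| + 1 by rewrite ltr_wpDl.
have [D RD [d d0 Dd]] := fu (e / 2 / (`|a| + 1)) ltac:(by rewrite !divr_gt0).
have [E RE [k k0 Ek]] := gu (e / 2) ltac:(by rewrite !divr_gt0).
exists (fun x y => Num.max (D x y) (E x y)); first exact: RP_max.
exists (Num.min d k) => [|x y]; first by rewrite lt_min d0.
rewrite gt_max !lt_min => /andP[/andP[/Dd fxy _] /andP[_ /Ek gxy]].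
have -> : (a *: f + g) x - (a *: f + g) y = a * (f x - f y) + (g x - g y).
  by rewrite mulrBr addrACA -opprD.
rewrite (le_lt_trans (ler_normD _ _))// (splitr e) ler_ltD// normrM.
apply: (@le_trans _ _ ((`|a| + 1) * (e / 2 / (`|a| + 1)))).
  by apply: ler_pM => //; [rewrite lerDl|exact: ltW].
by rewrite mulrC divfK// gt_eqF.
Qed.

HB.instance Definition _ := GRing.isSubmodClosed.Build R (rG -> R^o) Ub_pred
  Ub_submod.

Record Ub := MkUb { Ub_fun :> rG -> R^o ; Ub_mem : Ub_fun \in Ub_pred }.

HB.instance Definition _ := [isSub for Ub_fun].
HB.instance Definition _ := [Choice of Ub by <:].
HB.instance Definition _ := [SubChoice_isSubLmodule of Ub by <:].

Lemma UbP (f : Ub) : Ub_set f.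
Proof. exact/Ub_predP/Ub_mem. Qed.

Lemma Ub_ext (f g : Ub) : (forall x, f x = g x) -> f = g.
Proof. by move=> fg; apply: val_inj; apply: funext => x; exact: fg. Qed.

Definition supnorm (f : Ub) : R := sup (range (fun x => `|f x|)).

Lemma supnorm_ub (f : Ub) x : `|f x| <= supnorm f.
Proof.
have [/bounded_funE[C fC] _] := UbP f; apply: ub_le_sup; last by exists x.
by exists C => _ [y _ <-].
Qed.

Lemma supnorm_le (f : Ub) C : (forall x, `|f x| <= C) -> supnorm f <= C.
Proof.
move=> fC; apply: ge_sup; first by exists `|f (1%g : G)|; exists (1%g : G).
by move=> _ [x _ <-].
Qed.

Lemma supnormD (f g : Ub) : supnorm (f + g) <= supnorm f + supnorm g.
Proof.
apply: supnorm_le => x; apply: le_trans (ler_normD _ _) _.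
by rewrite lerD ?supnorm_ub.
Qed.

Lemma supnormZ (a : R) (f : Ub) : supnorm (a *: f) = `|a| * supnorm f.
Proof.
have le b (g : Ub) : supnorm (b *: g) <= `|b| * supnorm g.
  apply: supnorm_le => x.
  by rewrite [X in `|X|](_ : _ = b * g x)// normrM ler_wpM2l ?supnorm_ub.
apply/eqP; rewrite eq_le le /=; have [->|a0] := eqVneq a 0.
  rewrite normr0 mul0r; apply: le_trans (supnorm_ub _ (1%g : G)); exact: normr_ge0.
rewrite -ler_pdivlMl ?normr_gt0// -normfV.
by apply: le_trans (le _ _); rewrite scalerA mulVf// scale1r.
Qed.

Lemma supnorm0_eq0 (f : Ub) : supnorm f = 0 -> f = 0.
Proof.
move=> f0; apply: Ub_ext => x; apply/eqP.
by rewrite -normr_le0 -f0 supnorm_ub.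
Qed.

HB.instance Definition _ :=
  Lmodule_isNormed.Build R Ub supnormD supnormZ supnorm0_eq0.

Lemma Ub_normE (f : Ub) : `|f| = supnorm f.
Proof. by []. Qed.

Definition BLip (D : G -> G -> R) : set {ptws G -> R^o} :=
  [set f | (forall x, 0 <= f x <= 1) /\
           (forall x y, `|f x - f y| <= D x y)].

Lemma BLip_Ub (D : G -> G -> R) (f : {ptws G -> R^o}) : RP D -> BLip D f -> f \in Ub_pred.
Proof.
move=> RD [f01 fD]; apply/Ub_predP; split.
  apply/bounded_funE; exists 1 => x.
  by have /andP[f0 f1] := f01 x; rewrite ger0_norm.
apply/unif_continuousE => e e0; exists D => //; exists e => // x y.
exact: le_lt_trans.
Qed.

Definition BLip_incl (D : G -> G -> R) (RD : RP D) (f : BLip D) : Ub :=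
  MkUb (BLip_Ub RD (set_valP f)).

Definition rtrans (x : G) (f : G -> R) : G -> R := fun z => f (z * x)%g.

Definition orb (f : G -> R) : set {ptws G -> R^o} :=
  range (fun x => rtrans x f).

Definition ambitable : Prop :=
  forall D : G -> G -> R, RP D -> exists f : Ub, BLip D `<=` closure (orb f).

End BoundedUniform.

(* The norm dual carries the weak* topology: it is a subspace of the space of
   all functions V -> R with the topology of pointwise convergence. *)
Definition norm_dual (R : realType) (V : normedModType R) :
    set {ptws V -> R^o} :=
  [set mu | linear (mu : V -> R^o) /\ continuous (mu : V -> R^o)].
Arguments norm_dual {R} V.

Section Convolution.
Context (R : realType) (G : topologicalGroupType).
Local Notation rG := (right_unif R G).
Local Notation Ub := (Ub R G).

Definition M_rG : Type := norm_dual Ub.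

HB.instance Definition _ := Topological.on M_rG.

Definition M_fun (mu : M_rG) : Ub -> R := set_val mu.
Coercion M_fun : M_rG >-> Funclass.

Lemma M_lin (mu : M_rG) a (f g : Ub) : mu (a *: f + g) = a * mu f + mu g.
Proof. by have [mul _] := set_valP mu; exact: mul. Qed.

Lemma M_sub (mu : M_rG) (f g : Ub) : mu (f - g) = mu f - mu g.
Proof. by rewrite addrC -scaleN1r M_lin mulN1r addrC. Qed.

Lemma linear_continuousP (mu : Ub -> R^o) : linear mu ->
  continuous mu <-> exists C, forall f, `|mu f| <= C * `|f|.
Proof.
move=> mul; pose mulM := GRing.isLinear.Build R Ub R^o *:%R mu mul.
pose mu' : {linear Ub -> R^o} := HB.pack mu mulM.
split=> [muc|[C muC]].
  have /linear_bounded_continuous/linear_boundedP : continuous mu' by [].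
  case=> K [_ KC]; exists (K + 1); apply: KC; rewrite ltrDl//.
have /linear_bounded_continuous : bounded_near mu' (nbhs 0).
  apply/linear_boundedP; near=> r => f; apply: le_trans (muC f) _.
  by apply: ler_wpM2r; [exact: normr_ge0|near: r; apply: nbhs_pinfty_ge; exact: num_real].
by [].
Unshelve. all: by end_near. Qed.

Lemma M_bounded (mu : M_rG) :
  exists2 C, 0 <= C & forall f : Ub, `|mu f| <= C * `|f|.
Proof.
have [mul /(linear_continuousP mul)[C muC]] := set_valP mu.
exists `|C| => // f; apply: le_trans (muC f) _.
by rewrite ler_wpM2r ?ler_norm.
Qed.

Lemma M_mem (mu : Ub -> R) (C : R) :
    (forall a f g, mu (a *: f + g) = a * mu f + mu g) ->
    (forall f, `|mu f| <= C * `|f|) ->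
  norm_dual Ub mu.
Proof.
move=> mul muC; have mul' : linear (mu : Ub -> R^o) by [].
by split=> //; apply/(linear_continuousP mul'); exists C.
Qed.

Lemma delta_mem (x : G) : norm_dual Ub (fun f : Ub => f x).
Proof.
apply: (@M_mem _ 1) => // f; rewrite mul1r; exact: supnorm_ub.
Qed.

Definition delta_pt (x : G) : M_rG := SigSub (mem_set (delta_mem x)).

Lemma ltrans_mem (x : G) (f : Ub) :
  (fun y : G => f (x * y)%g) \in @Ub_pred R G.
Proof.
have [/bounded_funE[C fC] /unif_continuousE fu] := UbP f.
apply/Ub_predP; split; first by apply/bounded_funE; exists C => y; exact: fC.
apply/unif_continuousE => e e0; have [D RD [d d0 Dd]] := fu e e0.
exists (fun y z => D (x * y)%g (x * z)%g); first exact: RP_ltrans.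
by exists d => // y z; exact: Dd.
Qed.

Definition ltrans (x : G) (f : Ub) : Ub := MkUb (ltrans_mem x f).

Lemma conv_inner_bound (nu : M_rG) (f : Ub) C :
  (forall f : Ub, `|nu f| <= C * `|f|) -> 0 <= C ->
  forall x, `|nu (ltrans x f)| <= C * `|f|.
Proof.
move=> nuC C0 x; apply: le_trans (nuC _) _; rewrite ler_wpM2l//.
by apply: supnorm_le => y; exact: (supnorm_ub f (x * y)%g).
Qed.

Lemma conv_inner_mem (nu : M_rG) (f : Ub) :
  (fun x : G => nu (ltrans x f)) \in @Ub_pred R G.
Proof.
have [C C0 nuC] := M_bounded nu.
apply/Ub_predP; split.
  by apply/bounded_funE; exists (C * `|f|); exact: conv_inner_bound.
have [_ /unif_continuousE fu] := UbP f.
apply/unif_continuousE => e e0.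
have C1 : 0 < C + 1 by rewrite ltr_wpDl.
have [D RD [d d0 Dd]] := fu (e / 2 / (C + 1)) ltac:(by rewrite !divr_gt0).
exists D => //; exists d => // x y xy; rewrite -M_sub.
apply: (@le_lt_trans _ _ (e / 2)); last by rewrite ltr_pdivrMr// ltr_pMr// ltr1n.
apply: le_trans (nuC _) _.
apply: (@le_trans _ _ ((C + 1) * (e / 2 / (C + 1)))); last first.
  by rewrite mulrC divfK// gt_eqF.
apply: ler_pM => //; first by rewrite lerDl.
apply: supnorm_le => z; apply/ltW/Dd.
by have [_ _ Dr] := RD; rewrite Dr.
Qed.

Definition conv_inner (nu : M_rG) (f : Ub) : Ub := MkUb (conv_inner_mem nu f).

Lemma conv_mem (mu nu : M_rG) : norm_dual Ub (fun f => mu (conv_inner nu f)).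
Proof.
have [C C0 muC] := M_bounded mu; have [K K0 nuK] := M_bounded nu.
apply: (@M_mem _ (C * K)) => [a f g|f].
  rewrite -M_lin; congr (mu _); apply: Ub_ext => x /=.
  rewrite -[RHS]/(a * nu (ltrans x f) + nu (ltrans x g)) -M_lin.
  by congr (nu _); exact: Ub_ext.
apply: le_trans (muC _) _; rewrite -mulrA ler_wpM2l//.
by apply: supnorm_le => x; exact: conv_inner_bound.
Qed.

Definition convolution (mu nu : M_rG) : M_rG := SigSub (mem_set (conv_mem mu nu)).

Lemma deltaE x (f : Ub) : delta_pt x f = f x. Proof. by []. Qed.

Lemma convolutionE mu nu (f : Ub) : convolution mu nu f = mu (conv_inner nu f).
Proof. by []. Qed.

Definition rG_closure : set M_rG := closure (range delta_pt).

Definition Mu_rG : set M_rG :=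
  [set mu : M_rG | forall (D : G -> G -> R) (RD : RP D),
    continuous (fun f : BLip D => mu (BLip_incl RD f) : R^o)].

End Convolution.

Arguments rG_closure R G : clear implicits.
Arguments Mu_rG R G : clear implicits.

Definition is_semigroup (T : Type) (op : T -> T -> T) (S : set T) : Prop :=
  (forall x y, S x -> S y -> S (op x y)) /\
  (forall x y z, S x -> S y -> S z -> op x (op y z) = op (op x y) z).

(* {within S, continuous _} is continuity for the topology induced on S; as
   op x maps S to S, continuity into T and into S are the same. *)
Definition topological_centre (T : topologicalType) (op : T -> T -> T)
    (S : set T) : set T :=
  [set x | S x /\ {within S, continuous (op x)}].

(* Main.v *)
Require Import Defs.
From HB Require Import structures.
From mathcomp Require Import all_boot all_order all_algebra.
From mathcomp Require Import all_classical all_reals all_analysis.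
From mathcomp Require Import ring lra.
Local Open Scope classical_set_scope.

Set Implicit Arguments.
Unset Strict Implicit.
Unset Printing Implicit Defensive.
Import Order.TTheory GRing.Theory Num.Theory.
Import numFieldNormedType.Exports.
Local Open Scope ring_scope.

(** Both inclusions come from reading [convolution mu nu f] as [mu] applied to
    the function [x |-> nu (ltrans x f)], and asking how this function depends
    on [nu].

    Centre into [Mu_rG].  The map [nu |-> conv_inner nu f] is continuous from
    the weak* topology to pointwise convergence.  It sends [delta_pt y] to the
    right translate [rtrans y f], and [rG_closure] is weak* compact
    ([rG_closure_compact]), so the image of [rG_closure] is compact and contains
    the closure of the orbit of [f] ([closure_orb]).  Ambitability provides an
    [f] for which this closure contains [BLip D].  On [rG_closure] the composite
    of this map with [mu] is [nu |-> convolution mu nu f], which is continuous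
    when [mu] is in the centre; since a continuous surjection from a compact
    space onto a Hausdorff space is a quotient map, [mu] itself is continuous on
    [BLip D] ([centre_sub_Mu]).

    [Mu_rG] into the centre.  For [mu] in [Mu_rG] a Fubini formula holds
    ([Mu_fubini]): [mu (x |-> nu (y |-> f (x y))) = nu (y |-> mu (x |-> f (x y)))].
    Its right-hand side is the value of [nu] at a function of [Ub] that depends
    on [mu] and [f] only, hence is weak* continuous in [nu], also on unbounded
    sets of functionals.  To prove the formula, [nu] is replaced by a
    combination of point evaluations, for which the formula is the linearity of
    [mu].  By continuity on [BLip D] the functional [mu] hardly sees a bounded
    Lipschitz function that is small on a certain finite set [F]
    ([Mu_small]).  A partition of unity [p_i] with points [y_i], along which the
    finitely many functions [y |-> f (x y)], [x] in [F], hardly vary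
    ([adapted_partition]), makes [\sum_i nu p_i * delta_pt y_i] close enough to
    [nu] for both sides ([discretization]). *)

(** * Convergence and ultrafilters *)

Lemma fmap_ultra (T U : Type) (f : T -> U) (F : set_system T) :
  UltraFilter F -> UltraFilter (f @ F).
Proof.
move=> FU; split; first exact: fmap_proper_filter.
move=> H HP sFH; apply/seteqP; split=> [A HA|]; last exact: sFH.
have [//|FnA] := in_ultra_setVsetC (f @^-1` A) FU.
by have [x []] := filter_ex (filterI HA (sFH (~` A) FnA)).
Qed.

(** If a neighbourhood of the limit is missed, the filter meets its complement,
    and any ultrafilter refining the trace on the complement violates the
    hypothesis. *)
Lemma cvg_ultra (T : Type) (U : topologicalType) (F : set_system T)
    {FF : Filter F} (f : T -> U) (l : U) :
  (forall H, UltraFilter H -> F `<=` H -> f @ H --> l) -> f @ F --> l.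
Proof.
move=> ultra A lA; apply: contrapT.
rewrite -[nbhs _ _]/(F (f @^-1` A)) => nFA.
have FnA : ProperFilter (within (~` (f @^-1` A)) F).
  apply: Build_ProperFilter_ex => B; rewrite /within /= => FB.
  apply: contrapT => nB; apply: nFA.
  apply: (filterS _ FB) => x xB; apply: contrapT => nAx.
  by apply: nB; exists x; exact: xB.
have [H [HU sH]] := ultraFilterLemma FnA.
have HA : H (f @^-1` A).
  apply: (ultra H HU) lA => B FB; apply: sH; exact: (@cvg_within _ F _ _ B FB).
have HnA : H (~` (f @^-1` A)) by apply: sH; exact: withinT.
by have [x []] := filter_ex (filterI HA HnA).
Qed.

Lemma set_val_cvg (X : topologicalType) (A : set X) (F : set_system A)
    {FF : Filter F} (a : A) :
  F --> a <-> set_val @ F --> (set_val a : X).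
Proof.
split=> [Fa|Fa U [? /= [[W oW <-]]] Wa /filterS]; last first.
  by apply; apply: Fa; exact: open_nbhs_nbhs.
apply: (cvg_trans (cvg_app _ Fa)); exact: (@initial_continuous _ _ set_val).
Qed.

(** * Weak* compactness of the closure of the group *)

Section Functionals.
Context (R : realType) (G : topologicalGroupType).
Local Notation Ub := (Ub R G).
Local Notation M := (M_rG R G).

Lemma M_cvgP (F : set_system M) {FF : Filter F} (mu : M) :
  F --> mu <-> forall f : Ub, (fun nu : M => nu f : R^o) @ F --> (mu f : R^o).
Proof. by rewrite set_val_cvg pointwise_cvgP. Qed.

Lemma M_eval_continuous (f : Ub) : continuous (fun mu : M => mu f : R^o).
Proof. by move=> mu; exact: (@M_cvgP _ (nbhs_filter mu) mu).1 cvg_id f. Qed.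

Lemma rG_closure_bounded (nu : M) (f : Ub) :
  rG_closure R G nu -> `|nu f| <= `|f|.
Proof.
have: closed [set nu : M | nu f \in `[- `|f|, `|f|]].
  apply: (@preimage_closed _ _ (fun nu : M => nu f : R^o) [set` `[- `|f|, `|f|]]).
    by move=> x _; exact: M_eval_continuous.
  exact: interval_closed.
move=> /closure_id e.
have sub : range (@delta_pt R G) `<=` [set nu : M | nu f \in `[- `|f|, `|f|]].
  by move=> _ [x _ <-] /=; rewrite in_itv /= -ler_norml; exact: supnorm_ub.
move=> /(closureS sub); rewrite -e /=.
by rewrite in_itv /= -ler_norml.
Qed.

(** A Banach-Alaoglu argument: along an ultrafilter each [nu f] stays in a
    compact segment, hence converges, and the limits form a bounded linear
    functional. *)
Lemma rG_closure_compact : compact (rG_closure R G).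
Proof.
rewrite compact_ultra => F FU FK.
have FF : ProperFilter F by exact: ultra_proper.
have cvgF (f : Ub) : exists l : R, (fun nu : M => nu f : R^o) @ F --> (l : R^o) /\
     `|l| <= `|f|.
  have := @segment_compact R (- `|f|) `|f|; rewrite compact_ultra.
  move=> /(_ _ (fmap_ultra (fun nu : M => nu f) FU)) [|l [lf Fl]].
    suff : F [set nu : M | `|nu f| <= `|f|].
      by apply: (@filterS _ F) => nu; rewrite /= in_itv /= -ler_norml.
    by apply: (filterS _ FK) => nu /(rG_closure_bounded f).
  by exists l; split=> //; move: lf; rewrite /= in_itv /= -ler_norml.
have [L LF] := choice cvgF.
have Lmem : norm_dual Ub L.
  apply: (@M_mem _ _ L 1) => [a f g|f]; last by rewrite mul1r; case: (LF f).
  apply: (cvg_unique _ (LF _).1) => //=.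
  under eq_fun do rewrite M_lin.
  by apply: cvgD; [apply: cvgMl_tmp; exact: (LF f).1|exact: (LF g).1].
pose mu : M := SigSub (mem_set Lmem).
have Fmu : F --> mu by apply/M_cvgP => f; exact: (LF f).1.
exists mu; split=> //.
by apply: (@closed_cvg _ _ F FF id (rG_closure R G)) => //; exact: closed_closure.
Qed.

(** * The topological centre consists of functionals continuous on [BLip] *)

Lemma conv_inner_continuous (f : Ub) :
  continuous (fun nu : M => conv_inner nu f : {ptws G -> R^o}).
Proof.
move=> nu.
apply: (iffRL (@pointwise_cvgP G R^o _ _ (fmap_filter _ (nbhs_filter nu)))) => x.
exact: M_eval_continuous.
Qed.

(** The image of the compact set [rG_closure] is closed, and it contains the
    orbit as the image of the point evaluations. *)
Lemma closure_orb (f : Ub) (h : G -> R) : closure (orb f) h ->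
  exists2 nu, rG_closure R G nu & conv_inner nu f = h :> (G -> R).
Proof.
pose phi := fun nu : M => conv_inner nu f : {ptws G -> R^o}.
have cphi : compact (phi @` rG_closure R G).
  apply: continuous_compact rG_closure_compact.
  by apply: continuous_subspaceT; exact: conv_inner_continuous.
have /closure_id e : closed (phi @` rG_closure R G).
  apply: compact_closed cphi; apply: hausdorff_product => _.
  exact: norm_hausdorff.
have sub : orb f `<=` phi @` rG_closure R G.
  move=> _ [x _ <-]; exists (delta_pt R x) => //.
  by apply: subset_closure; exists x.
by move=> /(closureS sub); rewrite -e => -[nu Knu phinu]; exists nu.
Qed.

(** Each [k] in [BLip D] is lifted to some [N k] in [rG_closure] with
    [conv_inner (N k) f = k].  Along an ultrafilter tending to [h] the lifts
    converge by compactness; the limit is a lift of [h], and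
    [mu k = convolution mu (N k) f]. *)
Lemma centre_sub_Mu (S : set M) (mu : M) : ambitable R G ->
  rG_closure R G `<=` S -> {within S, continuous (convolution mu)} ->
  Mu_rG R G mu.
Proof.
move=> amb KS muc D RD h; have [f Df] := amb D RD.
have lift (k : BLip D) : exists nu,
    rG_closure R G nu /\ conv_inner nu f = BLip_incl RD k.
  have [nu Knu e] := closure_orb (Df _ (set_valP k)).
  by exists nu; split=> //; apply: Ub_ext => x; rewrite e.
have [N NP] := choice lift.
apply: (@cvg_ultra _ _ _ (nbhs_filter h)) => H HU Hh.
have HF : ProperFilter H by exact: ultra_proper.
have NU := fmap_ultra N HU.
have [nu Knu Nnu] : exists2 nu : M, rG_closure R G nu & N @ H --> nu.
  have := rG_closure_compact; rewrite compact_ultra => /(_ _ NU) [|nu []].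
    by apply: nearW => k; case: (NP k).
  by exists nu.
have Nf (g : Ub) : (fun k => N k g : R^o) @ H --> (nu g : R^o).
  exact: (iffLR (@M_cvgP (N @ H) _ nu) Nnu g).
have nuh : conv_inner nu f = BLip_incl RD h.
  apply: Ub_ext => x.
  apply: (@cvg_unique R^o _
    ((fun k : BLip D => (set_val k : G -> R) x : R^o) @ H)).
  - exact: norm_hausdorff.
  - apply: cvg_trans (Nf (ltrans x f)); apply: near_eq_cvg; apply: nearW => k.
    by rewrite -[LHS]/(conv_inner (N k) f x) (NP k).2.
  - have /set_val_cvg : H --> h by [].
    by move/(pointwise_cvgP); exact.
have muN (k : BLip D) : mu (BLip_incl RD k) = convolution mu (N k) f.
  by rewrite convolutionE (NP k).2.
rewrite -nuh.
rewrite -[X in X @ _](funext (fun k => esym (muN k))) -convolutionE.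
have /subspace_continuousP/(_ nu (KS _ Knu)) mun := muc.
have : convolution mu @ (N @ H) --> convolution mu nu.
  apply: cvg_trans mun; apply: cvg_app => A.
  rewrite /within /= => /Nnu HA.
  apply: (@filterS _ H _ _ _ _ HA) => k; apply; apply: KS; by case: (NP k).
by move=> /M_cvgP/(_ f).
Qed.

End Functionals.

(** * The orbit pseudometric of a bounded uniformly continuous function *)

Section RightTranslates.
Context (R : realType) (G : topologicalGroupType).
Local Notation Ub := (Ub R G).
Local Notation M := (M_rG R G).
Implicit Types (f k : Ub) (x y z t : G) (mu nu : M) (F s : seq G).

Lemma Ub_norm_ub (f : Ub) (x : G) : `|f x| <= `|f|.
Proof. exact: supnorm_ub. Qed.

Lemma Ub_norm_le (f : Ub) C : (forall x, `|f x| <= C) -> `|f| <= C.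
Proof. exact: supnorm_le. Qed.

Lemma Ub_intro (f : G -> R) (C : R) : (forall x, `|f x| <= C) ->
    (forall e : R, 0 < e -> exists2 D : G -> G -> R, RP D & exists2 d : R, 0 < d &
      forall x y, D x y < d -> `|f x - f y| < e) ->
  f \in @Ub_pred R G.
Proof.
move=> fC fu; apply/Ub_predP; split; first by apply/bounded_funE; exists C.
exact/unif_continuousE.
Qed.

Lemma RP_bigmax (I : Type) (s : seq I) (D : I -> G -> G -> R) :
  (forall i, RP (D i)) -> RP (fun x y : G => \big[Num.max/0]_(i <- s) D i x y).
Proof.
move=> RD; elim: s => [|i s IH].
  rewrite (_ : (fun _ _ => _) = fun _ _ => 0); first exact: RP0.
  by apply/funext => x; apply/funext => y; rewrite big_nil.
rewrite (_ : (fun _ _ => _) = fun x y : G =>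
  Num.max (D i x y) (\big[Num.max/0]_(i <- s) D i x y)).
  exact: RP_max.
by apply/funext => x; apply/funext => y; rewrite big_cons.
Qed.

(** The least right-invariant pseudometric for which [f] is 1-Lipschitz.  All
    right translates of [f] are then 1-Lipschitz as well. *)
Definition orbit_metric (f : Ub) (x y : G) : R :=
  sup (range (fun z : G => `|f (x * z)%g - f (y * z)%g|)).

Lemma orbit_metric_ub f x y z : `|f (x * z)%g - f (y * z)%g| <= orbit_metric f x y.
Proof.
apply: ub_le_sup; last by exists z.
exists (`|f| + `|f|) => _ [t _ <-]; apply: le_trans (ler_normB _ _) _.
by rewrite lerD ?Ub_norm_ub.
Qed.

Lemma orbit_metric_le f x y C :
  (forall z, `|f (x * z)%g - f (y * z)%g| <= C) -> orbit_metric f x y <= C.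
Proof.
move=> fC; apply: ge_sup => [|_ [z _ <-]] //.
by exists `|f (x * 1)%g - f (y * 1)%g|; exists 1%g.
Qed.

Lemma orbit_metric_unif f e : 0 < e ->
  exists2 D : G -> G -> R, RP D & exists2 d : R, 0 < d &
    forall x y, D x y < d -> orbit_metric f x y <= e.
Proof.
move=> e0; have [_ /unif_continuousE fu] := UbP f.
have [D RD [d d0 Dd]] := fu e e0; exists D => //; exists d => // x y xy.
apply: orbit_metric_le => z; apply/ltW/Dd.
by have [_ _ Dr] := RD; rewrite Dr.
Qed.

Lemma orbit_metric_RP f : RP (orbit_metric f).
Proof.
have le x y : orbit_metric f x y <= orbit_metric f y x.
  by apply: orbit_metric_le => z; rewrite distrC orbit_metric_ub.
have sym x y : orbit_metric f x y = orbit_metric f y x.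
  by apply/eqP; rewrite eq_le !le.
have tri x y z : orbit_metric f x z <= orbit_metric f x y + orbit_metric f y z.
  apply: orbit_metric_le => t; apply: le_trans (ler_distD (f (y * t)%g) _ _) _.
  by rewrite lerD ?orbit_metric_ub.
have refl x : orbit_metric f x x = 0.
  apply/eqP; rewrite eq_le; apply/andP; split.
    by apply: orbit_metric_le => z; rewrite subrr normr0.
  by apply: le_trans (normr_ge0 _) (orbit_metric_ub f x x 1%g).
have ge0 x y : 0 <= orbit_metric f x y.
  exact: le_trans (normr_ge0 _) (orbit_metric_ub f x y 1%g).
split; first by split.
- move=> [x y]; apply/cvgrPdist_le => e e0 /=.
  have e20 : 0 < e / 2 by rewrite divr_gt0.
  have [D [[_ Dxx Ds _] Dc _] [d d0 Dd]] := orbit_metric_unif f e20.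
  have near1 z : \forall t \near z, orbit_metric f z t <= e / 2.
    have : (fun t : G => D z t : R^o) @ z --> (D z z : R^o).
      apply: (@continuous_comp _ _ _ (fun t : G => (z, t))
        (fun z : G * G => D z.1 z.2 : R^o)).
        by apply: cvg_pair => /=; [exact: cvg_cst|exact: cvg_id].
      exact: Dc.
    rewrite Dxx => /cvgr_lt /(_ _ d0); apply: filterS => t; exact: Dd.
  exists ([set t | orbit_metric f x t <= e / 2],
          [set t | orbit_metric f y t <= e / 2]).
    by split; exact: near1.
  move=> [u v] [/= xu yv]; rewrite ler_norml; apply/andP; split.
    have := tri u x v; have := tri x y v; rewrite (sym u x); lra.
  have := tri x u y; have := tri u v y; rewrite (sym v y); lra.
- move=> x y z; apply/eqP; rewrite eq_le; apply/andP; split; apply: orbit_metric_le => t.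
    by rewrite -!mulgA orbit_metric_ub.
  by have := orbit_metric_ub f (x * z)%g (y * z)%g (z^-1 * t)%g; rewrite -!mulgA !mulVKg.
Qed.

Lemma rtrans_mem (y : G) (f : Ub) : rtrans y f \in @Ub_pred R G.
Proof.
apply: (@Ub_intro _ `|f|) => [x|e e0]; first exact: Ub_norm_ub.
exists (orbit_metric f); first exact: orbit_metric_RP.
by exists e => // x z; apply: le_lt_trans; exact: orbit_metric_ub.
Qed.

Definition rtransU (y : G) (f : Ub) : Ub := MkUb (rtrans_mem y f).

(** * Linear combinations and the topology of [BLip] *)

Lemma M0 (mu : M) : mu 0 = 0.
Proof. by rewrite -(subrr (0 : Ub)) M_sub subrr. Qed.

Lemma MZ (mu : M) a (f : Ub) : mu (a *: f) = a * mu f.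
Proof. by rewrite -[a *: f]addr0 M_lin M0 addr0. Qed.

Lemma M_sum (mu : M) (I : Type) (s : seq I) (a : I -> R) (f : I -> Ub) :
  mu (\sum_(i <- s) a i *: f i) = \sum_(i <- s) a i * mu (f i).
Proof.
elim: s => [|i s IH]; first by rewrite !big_nil M0.
by rewrite !big_cons M_lin IH.
Qed.

Lemma Ub_sumE (I : Type) (s : seq I) (a : I -> R) (f : I -> Ub) (x : G) :
  (\sum_(i <- s) a i *: f i) x = \sum_(i <- s) a i * f i x.
Proof. exact: (M_sum (delta_pt R x)). Qed.

Lemma BLip_nbhs (D : G -> G -> R) (h : BLip D) (U : set (BLip D)) : nbhs h U ->
  exists (F : seq G) (d : R), 0 < d /\ forall k : BLip D,
    (forall x, x \in F -> `|set_val h x - set_val k x| <= d) -> U k.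
Proof.
pose B (Fd : seq G * R) : set (BLip D) :=
  [set k | forall x, x \in Fd.1 -> `|set_val h x - set_val k x| <= Fd.2].
pose H := filter_from [set Fd : seq G * R | 0 < Fd.2] B.
have HF : Filter H.
  apply: filter_from_filter; first by exists ([::], 1) => /=.
  move=> [F d] [E e] /= d0 e0; exists (F ++ E, Num.min d e); first by rewrite /= lt_min d0.
  move=> k kB; split=> x xF; have := kB x; rewrite mem_cat xF ?orbT le_min => /(_ isT);
    by case/andP.
have Hh : H --> h.
  apply/set_val_cvg/pointwise_cvgP => x; apply/cvgrPdist_le => e e0.
  by exists ([:: x], e) => //= k; apply; rewrite inE.
by move=> /Hh[[F d] /= d0 BU]; exists F, d; split=> // k kB; exact: BU.
Qed.

(** Continuity at the single point [1/2] of [BLip D] is enough: a function [k]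
    bounded by [B] and [B * D]-Lipschitz gives the point [1/2 - k / (2 * B)] of
    [BLip D], and linearity turns closeness to [1/2] into smallness of
    [mu k]. *)
Lemma Mu_small (mu : M) (D : G -> G -> R) (B e : R) :
    Mu_rG R G mu -> RP D -> 0 < B -> 0 < e ->
  exists (F : seq G) (d : R), 0 < d /\ forall k : Ub,
    (forall x, `|k x| <= B) -> (forall x y, `|k x - k y| <= B * D x y) ->
    (forall x, x \in F -> `|k x| <= d) -> `|mu k| <= e.
Proof.
move=> mumu RD B0 e0.
have D0 x y : 0 <= D x y by case: RD => -[].
have half : BLip D (fun=> 2^-1).
  by split=> [x|x y]; [apply/andP; split; lra|rewrite subrr normr0].
pose h : BLip D := SigSub (mem_set half).
pose c := (2 * B)^-1.
have c0 : 0 < c by rewrite invr_gt0 mulr_gt0.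
have /cvgrPdist_le/(_ (c * e)) := mumu D RD h; rewrite mulr_gt0// => /(_ isT).
move=> /BLip_nbhs[F [d [d0 Fd]]]; exists F, (d / c); split; first by rewrite divr_gt0.
move=> k kB kL kF.
have hk : BLip D (fun x => 2^-1 - c * k x).
  have cB : c * B = 2^-1 by rewrite /c; field; rewrite gt_eqF.
  split=> [x|x y].
    have : `|c * k x| <= 2^-1 by rewrite normrM gtr0_norm// -cB ler_pM2l.
    by rewrite ler_norml => /andP[? ?]; apply/andP; split; lra.
  rewrite (_ : _ - _ = - (c * (k x - k y))); last by ring.
  rewrite normrN normrM gtr0_norm//; apply: le_trans (ler_wpM2l (ltW c0) (kL x y)) _.
  by rewrite mulrA cB ler_piMl//; lra.
have := Fd (SigSub (mem_set hk)) => /= muhk.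
have : `|c * mu k| <= c * e.
  rewrite -MZ (_ : c *: k = BLip_incl RD h - BLip_incl RD (SigSub (mem_set hk))).
    rewrite M_sub; apply: muhk => x xF /=.
    rewrite -[X in `|X|]/(2^-1 - (2^-1 - c * k x)) opprB addrC subrK.
    by rewrite normrM gtr0_norm// mulrC -ler_pdivlMr// kF.
  by apply: Ub_ext => x; rewrite /= -[RHS]/(2^-1 - (2^-1 - c * k x)) opprB [RHS]addrC subrK.
by rewrite normrM gtr0_norm// ler_pM2l.
Qed.

(** * Partitions of unity adapted to finitely many translates *)

(** Pigeonhole: the values [f (x * z)], [x] in [F], are made nonnegative
    by adding [`|f|], then rounded down to multiples of [e]; as [f] is bounded,
    finitely many codes occur, and one representative is kept for each. *)
Lemma orbit_net f F (e : R) : 0 < e ->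
  exists s, forall z, exists2 y, y \in s &
    forall x, x \in F -> `|f (x * z)%g - f (x * y)%g| <= e.
Proof.
move=> e0; pose v x z := (f (x * z)%g + `|f|) / e.
have v0 x z : 0 <= v x z.
  rewrite divr_ge0 ?(ltW e0)// -lerBlDr sub0r.
  by have := Ub_norm_ub f (x * z)%g; rewrite ler_norml => /andP[].
pose N := Num.truncn ((`|f| + `|f|) / e).
pose code z := [ffun i : 'I_(size F) => inord (Num.truncn (v (nth 1%g F i) z)) : 'I_N.+1].
have codeE z (i : 'I_(size F)) : code z i = Num.truncn (v (nth 1%g F i) z) :> nat.
  rewrite ffunE inordK// ltnS; apply: le_truncn.
  rewrite ler_pM2r ?invr_gt0// lerD2r.
  by apply: le_trans (ler_norm _) (Ub_norm_ub _ _).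
pose rep c := xget 1%g [set y | code y = c].
exists [seq rep c | c <- enum {ffun 'I_(size F) -> 'I_N.+1}] => z.
exists (rep (code z)); first by apply: map_f; rewrite mem_enum.
have eqc : code (rep (code z)) = code z.
  exact: (@xgetPex _ (1%g : G) [set y | code y = code z] (ex_intro _ z erefl)).
move=> x xF; have iF : (index x F < size F)%N by rewrite index_mem.
have tE : Num.truncn (v x (rep (code z))) = Num.truncn (v x z).
  have := codeE (rep (code z)) (Ordinal iF); have := codeE z (Ordinal iF).
  by rewrite eqc /= nth_index// => <- <-.
have := truncn_itv (v0 x z); have := truncn_itv (v0 x (rep (code z))); rewrite tE.
set n := (Num.truncn _)%:R; rewrite -addn1 natrD -/n => /andP[a1 a2] /andP[b1 b2].
have : `|v x z - v x (rep (code z))| <= 1 by rewrite ler_norml; apply/andP; split; lra.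
rewrite -mulrBl normrM (gtr0_norm (_ : 0 < e^-1)) ?invr_gt0// ler_pdivrMr//.
by rewrite mul1r opprD addrACA subrr addr0.
Qed.

(** Built from lattice operations only, by induction on the net: for each new
    point [y] the bump [1 - max (d z y / e - 1) 0], which is [1] near [y] and
    nonpositive far from it, contributes the part of it exceeding the sum of the
    previous functions. The sum is thereby the maximum of [0] and the
    bumps. Inequality [<= 1] keeps the induction going. *)
Lemma partition_of_unity (D : G -> G -> R) (d : G -> G -> R) (e : R) s :
    RP D -> (forall x y z, d x z <= D x y + d y z) -> 0 < e ->
  exists ps : seq (G * Ub),
    [/\ forall i, i \in ps -> forall z, 0 <= i.2 z,
        forall i, i \in ps -> forall z, i.2 z != 0 -> d z i.1 <= 2 * e,
        forall z, \sum_(i <- ps) i.2 z <= 1 &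
        forall z, (exists2 y, y \in s & d z y <= e) -> \sum_(i <- ps) i.2 z = 1].
Proof.
move=> RD dD e0; have dL x y z : `|d x z - d y z| <= D x y.
  have [[_ _ Ds _] _ _] := RD.
  rewrite ler_norml; apply/andP; split.
    by have := dD y x z; rewrite Ds; lra.
  by have := dD x y z; lra.
elim: s => [|y s [ps [p0 pd p1 ps1]]].
  by exists [::]; split=> // z; rewrite ?big_nil// => -[].
(* The scalar [1] only gives the sum the shape of [Ub_sumE]. *)
pose S : Ub := \sum_(i <- ps) 1 *: i.2.
have SE z : S z = \sum_(i <- ps) i.2 z.
  by rewrite Ub_sumE; apply: eq_bigr => i _; rewrite mul1r.
have S0 z : 0 <= S z by rewrite SE big_seq; apply: sumr_ge0 => i /p0.
pose q z := Num.max (1 - Num.max (d z y / e - 1) 0 - S z) 0.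
have qmem : q \in @Ub_pred R G.
  apply: (@Ub_intro _ 1) => [z|r r0].
    rewrite ger0_norm ?le_max ?lexx ?orbT// /q ge_max ler01 andbT.
    have := S0 z; have : 0 <= Num.max (d z y / e - 1) 0 by rewrite le_max lexx orbT.
    lra.
  exists (fun x z => Num.max (D x z) (orbit_metric S x z)).
    exact: RP_max RD (orbit_metric_RP S).
  exists (Num.min (e * (r / 2)) (r / 2)); first by rewrite lt_min !mulr_gt0 ?divr_gt0.
  move=> x z; rewrite gt_max !lt_min => /andP[/andP[xz _] /andP[_ Sxz]].
  have maxL (a b : R) : `|Num.max a 0 - Num.max b 0| <= `|a - b|.
    have ge (u v : R) : u <= v + `|u - v| by rewrite -lerBlDl ler_norm.
    rewrite ler_norml; have := ge a b; have := ge b a; rewrite (distrC b).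
    have := normr_ge0 (a - b).
    by case: (leP a 0); case: (leP b 0) => *; apply/andP; split; lra.
  have dxz : `|d x y / e - d z y / e| < r / 2.
    rewrite -mulrBl normrM (gtr0_norm (_ : 0 < e^-1)) ?invr_gt0// ltr_pdivrMr// mulrC.
    exact: le_lt_trans (dL x z y) xz.
  have Sl : `|S x - S z| < r / 2.
    by have := orbit_metric_ub S x z 1%g; rewrite !mulg1 => /le_lt_trans; apply.
  have mm := maxL (d x y / e - 1) (d z y / e - 1).
  rewrite [X in _ <= `|X|](_ : _ = d x y / e - d z y / e) in mm; last by ring.
  apply: le_lt_trans (maxL _ _) _.
  move: dxz Sl mm; set a := Num.max _ _; set b := Num.max _ _.
  set c := `|_ / e - _| => cr Sr abc.
  rewrite (_ : _ - _ = (b - a) - (S x - S z)); last by ring.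
  apply: le_lt_trans (ler_normB _ _) _; rewrite (distrC b).
  apply: (@lt_le_trans _ _ (r / 2 + r / 2)); last by lra.
  by apply: ltrD => //; exact: le_lt_trans abc cr.
exists ((y, MkUb qmem) :: ps); split.
- move=> i; rewrite inE => /predU1P[-> z /=|]; last exact: p0.
  by rewrite le_max lexx orbT.
- move=> i; rewrite inE => /predU1P[-> z /=|]; last exact: pd.
  move=> qz; rewrite leNgt; apply/negP => dz; move/eqP: qz; apply.
  have dze : 2 < d z y / e by rewrite ltr_pdivlMr.
  rewrite /q [X in 1 - X]max_l; last by lra.
  by rewrite max_r//; have := S0 z; lra.
- move=> z; rewrite big_cons -SE /= /q -lerBrDr ge_max subr_ge0 SE p1 andbT -SE.
  by rewrite lerD2r lerBlDr lerDl le_max lexx orbT.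
move=> z [x]; rewrite inE big_cons -SE /= /q => /predU1P[->|xs] dx.
  rewrite [X in 1 - X]max_r ?subr0; last by rewrite subr_le0 ler_pdivrMr// mul1r.
  by rewrite max_l ?subrK// subr_ge0 SE.
have -> : S z = 1 by rewrite SE; apply: ps1; exists x.
rewrite max_r ?add0r// subr_le0 lerBlDr lerDl le_max lexx orbT//.
Qed.

(** The supremum over [F] of the oscillations of [f] is a pseudometric for which
    [orbit_net] gives finite nets, and it is dominated by a member of [RP], which
    makes the functions of the partition uniformly continuous. *)
Lemma adapted_partition f F (r : R) : 0 < r ->
  exists ps : seq (G * Ub),
    [/\ forall i, i \in ps -> forall z, 0 <= i.2 z,
        forall z, \sum_(i <- ps) i.2 z = 1 &
        forall i, i \in ps -> forall z, i.2 z != 0 -> forall x, x \in F ->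
          `|f (x * z)%g - f (x * i.1)%g| <= r].
Proof.
move=> r0; have r20 : 0 < r / 2 by rewrite divr_gt0.
have [s sP] := orbit_net f F r20.
pose D (y z : G) := \big[Num.max/0]_(x <- F) orbit_metric f (x * y)%g (x * z)%g.
pose dist (y z : G) := \big[Num.max/0]_(x <- F) `|f (x * y)%g - f (x * z)%g|.
have RD : RP D by exact: (RP_bigmax _ (fun x => RP_ltrans x (orbit_metric_RP f))).
have ub (h : G -> R) x : x \in F -> h x <= \big[Num.max/0]_(t <- F) h t.
  by move=> xF; exact: (@le_bigmax_seq _ _ _ _ 0 x xpredT h).
have distD x y z : dist x z <= D x y + dist y z.
  rewrite {1}/dist big_seq; apply: bigmax_le => [|t tF].
    by rewrite addr_ge0// /D /dist; apply: bigmax_ge_id.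
  apply: le_trans (ler_distD (f (t * y)%g) _ _) _; apply: lerD.
    have := orbit_metric_ub f (t * x)%g (t * y)%g 1%g; rewrite !mulg1.
    move=> /le_trans; apply; exact: (ub (fun t => orbit_metric f (t * x)%g (t * y)%g)).
  exact: (ub (fun t => `|f (t * y)%g - f (t * z)%g|)).
have [ps [p0 pd _ p1]] := partition_of_unity s RD distD r20.
have {}p1 z : \sum_(i <- ps) i.2 z = 1.
  have [y ys yz] := sP z; apply: p1; exists y => //.
  by rewrite /dist big_seq; apply: bigmax_le => [|x]; [exact: ltW|exact: yz].
have {}pd i : i \in ps -> forall z, i.2 z != 0 -> forall x, x \in F ->
    `|f (x * z)%g - f (x * i.1)%g| <= r.
  move=> ips z pz x xF; rewrite -(_ : 2 * (r / 2) = r); last by field.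
  apply: le_trans (pd _ ips _ pz).
  exact: (ub (fun x => `|f (x * z)%g - f (x * i.1)%g|)).
by exists ps.
Qed.

(** * A Fubini formula *)

(** As the [i.2] sum to [1], the function [f - \sum_i f i.1 *: i.2] takes at [z]
    the value [\sum_i (f z - f i.1) * i.2 z], an average of oscillations. *)
Lemma discretization nu f (ps : seq (G * Ub)) (B C : R) :
    (forall g : Ub, `|nu g| <= C * `|g|) -> 0 <= C ->
    (forall i, i \in ps -> forall z, 0 <= i.2 z) ->
    (forall z, \sum_(i <- ps) i.2 z = 1) ->
    (forall i, i \in ps -> forall z, i.2 z != 0 -> `|f z - f i.1| <= B) ->
  `|nu f - \sum_(i <- ps) f i.1 * nu i.2| <= C * B.
Proof.
move=> nuC C0 p0 p1 pB; rewrite -M_sum -M_sub.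
apply: le_trans (nuC _) _; rewrite ler_wpM2l//; apply: Ub_norm_le => z.
rewrite -[X in `|X|]/(f z - (\sum_(i <- ps) f i.1 *: i.2) z) Ub_sumE.
rewrite -[f z]mulr1 -(p1 z) mulr_sumr -sumrB -[B]mulr1 -(p1 z) mulr_sumr.
rewrite big_seq [leRHS]big_seq; apply: le_trans (ler_norm_sum _ _ _) _.
apply: ler_sum => i ips; have [->|pz] := eqVneq (i.2 z) 0.
  by rewrite !mulr0 subrr normr0.
by rewrite -mulrBl normrM (ger0_norm (p0 _ ips z)) ler_wpM2r ?p0// pB.
Qed.

Lemma rtransU_sub_bound f y z x : `|(rtransU y f - rtransU z f) x| <= 2 * `|f|.
Proof.
apply: le_trans (ler_normB _ _) _; have := Ub_norm_ub f (x * y)%g.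
by have := Ub_norm_ub f (x * z)%g; rewrite /rtrans; lra.
Qed.

Lemma rtransU_sub_lip f y z x t :
  `|(rtransU y f - rtransU z f) x - (rtransU y f - rtransU z f) t| <=
  2 * orbit_metric f x t.
Proof.
have kE u : (rtransU y f - rtransU z f) u = f (u * y)%g - f (u * z)%g by [].
rewrite !kE (_ : _ - _ - _ =
  (f (x * y)%g - f (t * y)%g) - (f (x * z)%g - f (t * z)%g)); last by ring.
apply: le_trans (ler_normB _ _) _; have := orbit_metric_ub f x t y.
by have := orbit_metric_ub f x t z; lra.
Qed.

(** The second conclusion is the first one for the difference of two
    translates of [f]; it gives the uniform continuity of
    [y |-> mu (rtransU y f)]. *)
Lemma Mu_small_rtrans mu f (B e : R) :
    Mu_rG R G mu -> 2 * (`|f| + 1) <= B -> 0 < e ->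
  exists F (d : R), [/\ 0 < d,
    forall k, (forall x, `|k x| <= B) ->
      (forall x y, `|k x - k y| <= B * orbit_metric f x y) ->
      (forall x, x \in F -> `|k x| <= d) -> `|mu k| <= e &
    forall y z, (forall x, x \in F -> `|f (x * y)%g - f (x * z)%g| <= d) ->
      `|mu (rtransU y f) - mu (rtransU z f)| <= e].
Proof.
move=> mumu fB e0; have f0 := normr_ge0 f.
have B0 : 0 < B by lra.
have [F [d [d0 Fd]]] := Mu_small mumu (orbit_metric_RP f) B0 e0.
exists F, d; split=> // y z yz; rewrite -M_sub; apply: Fd => [x|x t|x /yz //].
  by apply: le_trans (rtransU_sub_bound _ _ _ _) _; lra.
apply: le_trans (rtransU_sub_lip _ _ _ _ _) _; apply: ler_wpM2r; last by lra.
exact: le_trans (normr_ge0 _) (orbit_metric_ub f x t 1%g).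
Qed.

Lemma right_inner_mem mu f : Mu_rG R G mu ->
  (fun y : G => mu (rtransU y f)) \in @Ub_pred R G.
Proof.
move=> mumu; have [C C0 muC] := M_bounded mu.
apply: (@Ub_intro _ (C * `|f|)) => [y|e e0].
  apply: le_trans (muC _) _; rewrite ler_wpM2l//; apply: Ub_norm_le => x.
  exact: (Ub_norm_ub f (x * y)%g).
have e20 : 0 < e / 2 by rewrite divr_gt0.
have [F [d [d0 _ Fd]]] := @Mu_small_rtrans mu f _ _ mumu (lexx _) e20.
exists (fun y z : G => \big[Num.max/0]_(x <- F) orbit_metric f (x * y)%g (x * z)%g).
  by apply: (RP_bigmax _ (fun x => RP_ltrans x (orbit_metric_RP f))).
exists d => // y z yz; apply: (@le_lt_trans _ _ (e / 2)); last by lra.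
apply: Fd => x xF.
apply: ltW; apply: le_lt_trans yz.
have := orbit_metric_ub f (x * y)%g (x * z)%g 1%g; rewrite !mulg1 => /le_trans; apply.
exact: (@le_bigmax_seq _ _ _ _ 0 x xpredT (fun x : G => orbit_metric f (x * y)%g (x * z)%g)).
Qed.

(** The counterpart of [conv_inner] in which the first variable of [f (x * y)]
    is integrated. *)
Definition right_inner mu f (mumu : Mu_rG R G mu) : Ub := MkUb (right_inner_mem f mumu).

(** Replacing [nu] by [\sum_i nu i.2 * delta_pt i.1] changes the left-hand side
    by [mu k] with [k] bounded, Lipschitz and at most [d] on [F], and the
    right-hand side by at most [C * e'], [C] being a bound of [nu]. *)
Lemma Mu_fubini mu nu f (mumu : Mu_rG R G mu) :
  convolution mu nu f = nu (right_inner f mumu).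
Proof.
have [C C0 nuC] := M_bounded nu.
(* [B] dominates the bound [C * (2 * `|f|)] of [k], its Lipschitz constant
   [C * 2] for [orbit_metric f], and the constant needed for differences of translates. *)
pose B := 2 * (C + 1) * (`|f| + 1).
have f0 := normr_ge0 f.
have fB : 2 * (`|f| + 1) <= B by rewrite /B; nra.
apply/eqP; rewrite -subr_eq0 -normr_le0; apply/ler_addgt0Pl => e e0; rewrite addr0.
have C1 : 0 < C + 1 by rewrite ltr_wpDl.
pose e' := e / (C + 1).
have e'0 : 0 < e' by rewrite divr_gt0.
have [F [d [d0 smallk smallg]]] := Mu_small_rtrans mumu fB e'0.
pose r := d / (C + 1).
have r0 : 0 < r by rewrite divr_gt0.
have rd : r * (C + 1) = d by rewrite /r; field; rewrite gt_eqF.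
have [ps [p0 p1 pd]] := adapted_partition f F r0.
have disc (g : Ub) b := @discretization nu g ps b C nuC C0 p0 p1.
pose k := conv_inner nu f - \sum_(i <- ps) nu i.2 *: rtransU i.1 f.
have kE x : k x = nu (ltrans x f) - \sum_(i <- ps) ltrans x f i.1 * nu i.2.
  rewrite -[LHS]/(conv_inner nu f x - (\sum_(i <- ps) nu i.2 *: rtransU i.1 f) x).
  by rewrite Ub_sumE; congr (_ - _); apply: eq_bigr => i _; rewrite mulrC.
have muk : `|mu k| <= e'.
  apply: smallk => [x|x t|x xF].
  - rewrite kE; apply: le_trans (disc _ (2 * `|f|) _) _; last by rewrite /B; nra.
    move=> i _ z _; apply: le_trans (ler_normB _ _) _.
    by have := Ub_norm_ub f (x * z)%g; have := Ub_norm_ub f (x * i.1)%g; rewrite /=; lra.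
  - have -> : k x - k t = nu (ltrans x f - ltrans t f) -
        \sum_(i <- ps) (ltrans x f - ltrans t f) i.1 * nu i.2.
      rewrite !kE M_sub (_ : \sum_(i <- ps) (ltrans x f - ltrans t f) i.1 * nu i.2 =
        \sum_(i <- ps) ltrans x f i.1 * nu i.2 - \sum_(i <- ps) ltrans t f i.1 * nu i.2).
        by ring.
      by rewrite -sumrB; apply: eq_bigr => i _; rewrite -mulrBl.
    have om0 := le_trans (normr_ge0 _) (orbit_metric_ub f x t 1%g).
    apply: le_trans (disc _ (2 * orbit_metric f x t) _) _; last first.
      by rewrite mulrA ler_wpM2r// /B; nra.
    move=> i _ z _.
    rewrite -[X in `|X - _|]/(f (x * z)%g - f (t * z)%g).
    rewrite -[X in `|_ - X|]/(f (x * i.1)%g - f (t * i.1)%g).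
    apply: le_trans (ler_normB _ _) _.
    by have := orbit_metric_ub f x t z; have := orbit_metric_ub f x t i.1; lra.
  - rewrite kE; apply: le_trans (disc _ r _) _; last by rewrite -rd; nra.
    by move=> i ips z pz; exact: pd.
have gE : `|nu (right_inner f mumu) - \sum_(i <- ps) mu (rtransU i.1 f) * nu i.2| <= C * e'.
  apply: (disc (right_inner f mumu)) => i ips z pz; apply: smallg => x xF.
  by apply: le_trans (pd _ ips _ pz _ xF) _; rewrite -rd; nra.
have mukE : mu k = convolution mu nu f - \sum_(i <- ps) mu (rtransU i.1 f) * nu i.2.
  by rewrite M_sub M_sum convolutionE; congr (_ - _); apply: eq_bigr => i _; rewrite mulrC.
rewrite mukE in muk.
rewrite (_ : e = e' + C * e'); last by rewrite /e'; field; rewrite gt_eqF.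
apply: le_trans (ler_distD (\sum_(i <- ps) mu (rtransU i.1 f) * nu i.2) _ _) _.
by rewrite lerD// distrC.
Qed.

End RightTranslates.

Theorem theorem5p3 (R : realType) (G : topologicalGroupType)
    (S : set (M_rG R G)) :
  hausdorff_space G -> ambitable R G ->
  is_semigroup (@convolution R G) S -> rG_closure R G `<=` S ->
  topological_centre (@convolution R G) S = Mu_rG R G `&` S.
Proof.
move=> _ amb _ KS; apply/seteqP; split=> [mu [Smu muc]|mu [mumu Smu]].
  by split=> //; exact: centre_sub_Mu KS muc.
split=> //; apply: continuous_subspaceT => nu.
apply/(@M_cvgP _ _ _ (fmap_filter _ (nbhs_filter nu))) => f.
have e : (fun nu' : M_rG R G => nu' f : R^o) \o convolution mu =
    fun nu' : M_rG R G => nu' (right_inner f mumu).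
  by apply/funext => nu'; exact: Mu_fubini.
by have := @M_eval_continuous R G (right_inner f mumu) nu; rewrite -e; exact.
Qed.
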